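(* Let $R$ be a local algebra with maximal ideal $\mathfrak{m}$, and let $W$ be a hyperplane in $\mathfrak{m}$ that generates $R$ as an algebra with unit. Let $d$ be the maximal exponent such that $W$ does not contain the ideal $\mathfrak{m}^d$. Fix an isomorphism $\mathfrak{m}/W\cong\mathbb{K}$ and let $\pi\colon\mathfrak{m}\to\mathfrak{m}/W\cong\mathbb{K}$ be the projection. Let $F_W\colon R\times\cdots\times R\to\mathbb{K}$ be the $d$-linear form determined by linearity (using $R=\langle 1\rangle\oplus\mathfrak{m}$) by the following values when each argument is either the unit $1$ or an element of $\mathfrak{m}$: $$F_W(b_1,\ldots,b_d)=(-1)^k\,k!\,(d-k-1)!\,\pi(b_1\cdots b_d),$$ where $k<d$ is the number of units among $b_1,\ldots,b_d$, and $F_W(1,\ldots,1)=0$ for $k=d$. Then the form $F_W$ is an irreducible invariant $d$-linear form on $R$.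
   Context: The ground field $\mathbb{K}$ is algebraically closed of characteristic zero. A local algebra is a finite-dimensional commutative associative local $\mathbb{K}$-algebra with unit. A hyperplane in $\mathfrak{m}$ is a linear subspace of codimension one. Invariant form: an invariant $d$-linear form on $R$ is a $d$-linear symmetric map $F\colon R\times\cdots\times R\to\mathbb{K}$ such that $F(1,1,\ldots,1)=0$, the restriction of $F$ to $\mathfrak{m}$ is nonzero, and there exists a hyperplane $W$ in $\mathfrak{m}$ which generates $R$ as an algebra with unit and such that $$F(ab_1,b_2,\ldots,b_d)+F(b_1,ab_2,\ldots,b_d)+\cdots+F(b_1,b_2,\ldots,ab_d)=0\quad\text{for all } a\in W,\ b_1,\ldots,b_d\in R.$$ In this case $F$ is said to be invariant with respect to $W$; for $F_W$ the hyperplane is the given $W$. Irreducible: if $F_1$ and $F_2$ are invariant $d_1$-linear and $d_2$-linear forms on $R$ with respect to the same hyperplane $W$, then the product $F_1F_2$ defines an invariant $(d_1+d_2)$-linear form (the symmetric multilinear form whose associated polynomial is $F_1(v,\ldots,v)F_2(v,\ldots,v)$). An invariant multilinear form is irreducible if it cannot be represented as such a product. *)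

(* Defs.v *)
From HB Require Import structures.
From mathcomp Require Import all_boot all_order all_fingroup all_algebra.
From mathcomp Require Import falgebra.

Set Implicit Arguments.
Unset Strict Implicit.
Unset Printing Implicit Defensive.

Import GRing.Theory.
Local Open Scope ring_scope.

(* Finite-dimensional commutative associative unital algebras. *)
#[short(type="comFalgType")]
HB.structure Definition ComFalgebra (K : nzRingType) :=
  { A of Falgebra K A & GRing.ComUnitAlgebra K A }.

Section LocalAlgebras.
Variables (K : fieldType) (R : comFalgType K).

(* As R contains K, every ring ideal is a subspace, so {vspace R} loses none. *)
Definition ideal (I : {vspace R}) : Prop :=
  forall a x, x \in I -> a * x \in I.

Definition maximal_ideal (m : {vspace R}) : Prop :=
  [/\ ideal m, m != fullv
    & forall J : {vspace R}, ideal J -> (m <= J)%VS -> J = m \/ J = fullv].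

(* R is local, with maximal ideal m. *)
Definition local_algebra (m : {vspace R}) : Prop :=
  maximal_ideal m /\ forall n, maximal_ideal n -> n = m.

Definition hyperplane (m W : {vspace R}) : Prop :=
  (W <= m)%VS /\ \dim m = (\dim W).+1.

(* agenv W is the smallest subalgebra containing 1 and W. *)
Definition generates (W : {vspace R}) : Prop := agenv W = fullv.

End LocalAlgebras.

(* q : M -> Q presents Q as the quotient space of M by the subspace of those
   elements satisfying P. *)
Definition quotient_map (K : fieldType) (M Q : vectType K) (P : pred M)
    (q : 'Hom(M, Q)) : Prop :=
  limg q = fullv /\ forall x, (q x == 0) = P x.

Section Forms.
Variables (K : fieldType) (R : comFalgType K).

Definition multiform (d : nat) := {ffun 'I_d -> R} -> K.

Definition set_arg d (b : {ffun 'I_d -> R}) (i : 'I_d) (x : R) :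
    {ffun 'I_d -> R} :=
  [ffun j => if j == i then x else b j].

Definition multilinear d (F : multiform d) : Prop :=
  forall (b : {ffun 'I_d -> R}) (i : 'I_d) (c : K) (x y : R),
    F (set_arg b i (c *: x + y)) = c * F (set_arg b i x) + F (set_arg b i y).

Definition symmetric_form d (F : multiform d) : Prop :=
  forall (s : 'S_d) (b : {ffun 'I_d -> R}), F [ffun i => b (s i)] = F b.

(* F is an invariant d-linear form on R with respect to W, where m is the
   maximal ideal. *)
Definition invariant_form (m W : {vspace R}) d (F : multiform d) : Prop :=
  [/\ multilinear F /\ symmetric_form F,
      F [ffun=> 1] = 0,
      exists b : {ffun 'I_d -> R}, (forall i, b i \in m) /\ F b != 0,
      hyperplane m W /\ generates W
    & forall (a : R) (b : {ffun 'I_d -> R}), a \in W ->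
        \sum_(i < d) F (set_arg b i (a * b i)) = 0].

(* F is the product F1 F2: the symmetric multilinear form of degree d1 + d2
   whose associated polynomial is the product of those of F1 and F2. *)
Definition form_product d1 d2 d (F1 : multiform d1) (F2 : multiform d2)
    (F : multiform d) : Prop :=
  [/\ d = (d1 + d2)%N, multilinear F, symmetric_form F
    & forall v : R, F [ffun=> v] = F1 [ffun=> v] * F2 [ffun=> v]].

(* The degrees d1, d2 are automatically positive: an invariant form has
   F(1, ..., 1) = 0 and is nonzero, so its degree is not 0. *)
Definition irreducible_form (m : {vspace R}) d (F : multiform d) : Prop :=
  ~ exists (d1 d2 : nat) (F1 : multiform d1) (F2 : multiform d2)
           (W : {vspace R}),
      [/\ invariant_form m W F1, invariant_form m W F2
        & form_product F1 F2 F].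

(* The d-linear forms taking the values prescribed for F_W on tuples of units
   and elements of m.  If k < d the product of the b i lies in m, and there
   vsproj m is just the identity, seen as a map into the type subvs_of m. *)
Definition is_FW (m : {vspace R}) (pi : 'Hom(subvs_of m, K^o)) d
    (F : multiform d) : Prop :=
  [/\ multilinear F,
      F [ffun=> 1] = 0
    & forall b : {ffun 'I_d -> R}, (forall i, b i = 1 \/ b i \in m) ->
        let k := #|[set i | b i == 1]| in
        (k < d)%N ->
        F b = (-1 : K) ^+ k * k`!%:R * (d - k - 1)`!%:R
              * pi (vsproj m (\prod_(i < d) b i))].

End Forms.

(* Main.v *)
(* As K is algebraically closed, R = <1> + m, so a multilinear form on R is
   determined by its values on tuples of units and elements of m; uniqueness,
   symmetry and invariance of F_W are checked there.  Invariance reduces to the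
   cancellation of k * c (k - 1) with (d - k) * c k, where
   c k = (-1)^k k! (d - k - 1)!, and to pi vanishing on W and on m^(d+1).
   If F_W = F1 F2 with F1 and F2 vanishing at v = 1, then F_W(v, ..., v)
   vanishes to second order at v = 1; but its derivative at 1 in the direction
   x of m is a nonzero multiple of pi x. *)
Require Import Defs.
From HB Require Import structures.
From mathcomp Require Import all_boot all_order all_fingroup all_algebra.
From mathcomp Require Import falgebra ring.

Set Implicit Arguments.
Unset Strict Implicit.
Unset Printing Implicit Defensive.

Import GRing.Theory VectorInternalTheory.
Local Open Scope ring_scope.

(** * Ideals of a local algebra and powers of a subspace *)

Section LocalAlgebras.
Variables (K : fieldType) (R : comFalgType K).
Implicit Types (m I U : {vspace R}) (x y : R).

Lemma ideal_fullv I : ideal I -> 1 \in I -> I = fullv.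
Proof.
move=> idI I1; apply/eqP; rewrite eqEsubv subvf.
by apply/subvP=> x _; rewrite -[x]mulr1; apply: idI.
Qed.

Lemma maximal_ideal_notin1 m : maximal_ideal m -> 1 \notin m.
Proof. by case=> idm /eqP m_neq _; apply/negP=> /(ideal_fullv idm). Qed.

(** Induction on the codimension of [I]: either [I] is maximal, hence equal to [m], or it lies in a
    strictly larger proper ideal. *)
Lemma proper_ideal_sub_local m I :
  local_algebra m -> ideal I -> I != fullv -> (I <= m)%VS.
Proof.
case=> maxm uniqm.
have [n] := ubnP (\dim {:R} - \dim I); elim: n I => // n IHn I.
rewrite ltnS => leIn idI I_neq; apply: contraT => nIm.
suffices /uniqm eqIm : maximal_ideal I by rewrite eqIm subvv in nIm.
split=> // J idJ leIJ; have [->|J_neqI] := eqVneq J I; first by left.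
have [->|J_neq] := eqVneq J fullv; first by right.
case/negP: nIm; apply: (subv_trans leIJ (IHn J _ idJ J_neq)).
apply: leq_trans leIn; rewrite ltn_sub2l //.
  rewrite ltnNge; apply: contra I_neq => ?.
  by rewrite eqEdim subvf.
by rewrite ltnNge; apply: contra J_neqI => ?; rewrite eq_sym eqEdim leIJ.
Qed.

Lemma ideal_annihilator y : ideal (lker (amulr y)).
Proof.
by move=> a x; rewrite !memv_ker !lfunE /= -mulrA => /eqP->; rewrite mulr0.
Qed.

(** The annihilator of a nonzero [y] is an ideal without 1, hence proper. *)
Lemma annihilator_sub_local m x y :
  local_algebra m -> y != 0 -> x * y = 0 -> x \in m.
Proof.
move=> locm y_neq0 xy0.
suffices /subvP: (lker (amulr y) <= m)%VS.
  by apply; rewrite memv_ker lfunE /= xy0.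
apply: proper_ideal_sub_local locm (@ideal_annihilator y) _.
apply: contra y_neq0 => /eqP eqf.
by have := memvf (1 : R); rewrite -eqf memv_ker lfunE /= mul1r.
Qed.

Lemma memv_expv m n (b : 'I_n -> R) :
  (forall i, b i \in m) -> \prod_i b i \in (m ^+ n)%VS.
Proof.
elim: n b => [|n IHn] b bm; first by rewrite big_ord0 memv_line.
by rewrite big_ord_recl expvSl memv_mul // IHn.
Qed.

Lemma expv_nsubP m n U :
  ~~ (m ^+ n <= U)%VS ->
  exists b : 'I_n -> R, (forall i, b i \in m) /\ \prod_i b i \notin U.
Proof.
elim: n U => [|n IHn] U.
  by rewrite -memvE => U1; exists (fun=> 0); rewrite big_ord0; split=> // -[].
rewrite expvSl => nmU.
(* If multiplication by every basis vector of [m] sent [m ^+ n] into [U], then [m ^+ n.+1] would lie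
   in [U]; the failing vector is the first factor of the product sought. *)
have /allPn[x xm nxU]:
    ~~ all (fun x => m ^+ n <= amull x @^-1: U)%VS (vbasis m).
  apply: contra nmU => /allP mU; apply/prodvP=> u v um vmn.
  rewrite (coord_vbasis um) mulr_suml rpred_sum // => i _.
  rewrite -scalerAl rpredZ //.
  have /mU/subvP/(_ v vmn) : (vbasis m)`_i \in vbasis m.
    by rewrite mem_nth ?size_tuple.
  by rewrite -memv_preim lfunE.
have [b [bm bU]] := IHn _ nxU.
exists (fun i => oapp b x (unlift ord0 i)); split=> [i|].
  by case: unliftP => [j|] _ //=; apply: vbasis_mem.
rewrite big_ord_recl unlift_none /=.
under eq_bigr do rewrite liftK /=.
by rewrite -memv_preim lfunE in bU.
Qed.

End LocalAlgebras.

(** * The residue field is the ground field *)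

Lemma eigenvalue_exists (K : closedFieldType) (V : vectType K) (f : 'End(V)) :
  (0 < \dim {:V})%N -> exists a : K, exists2 v, v != 0 & f v = a *: v.
Proof.
move=> V_gt0; pose g := v2r \o f \o r2v.
have /closed_rootP[a] : size (char_poly (lin1_mx g)) != 1%N.
  by rewrite size_char_poly eqSS -lt0n -dimvf.
rewrite -eigenvalue_root_char => /eigenvalueP[v].
rewrite mul_rV_lin1 /= => /(congr1 r2v); rewrite v2rK linearZ /= => fv v_neq0.
exists a, (r2v v) => //; apply: contraNneq v_neq0 => v0.
by rewrite -[v]r2vK v0 linear0.
Qed.

(** Multiplication by [x] has an eigenvector [y] with some eigenvalue [a]; then [x - a%:A] kills
    [y], so it lies in [m]. *)
Lemma local_algebra_decomp (K : closedFieldType) (R : comFalgType K)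
    (m : {vspace R}) :
  local_algebra m -> (m + 1 = fullv)%VS /\ (m :&: 1 = 0)%VS.
Proof.
move=> locm; split; apply/eqP.
  rewrite eqEsubv subvf; apply/subvP=> x _.
  have [|a [y y_neq0]] := @eigenvalue_exists _ _ (amull x).
    rewrite lt0n dimv_eq0; apply: contraTneq (memvf (1 : R)) => ->.
    by rewrite memv0 oner_eq0.
  rewrite lfunE /= => xy; apply/memv_addP; exists (x - a%:A).
    apply: annihilator_sub_local locm y_neq0 _.
    by rewrite mulrBl xy mulr_algl subrr.
  by exists a%:A; rewrite ?subrK // memvZ ?memv_line.
rewrite -subv0; apply/subvP=> x; rewrite memv_cap => /andP[xm /vlineP[c xE]].
have [|c_neq0] := eqVneq c 0; first by rewrite xE => ->; rewrite scale0r mem0v.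
case/negP: (maximal_ideal_notin1 locm.1).
by rewrite -[1](scalerK c_neq0) -xE memvZ.
Qed.

(** * Extensionality and first-order expansion of multilinear forms *)

Section MultilinearForms.
Variables (K : fieldType) (R : comFalgType K) (d : nat).
Implicit Types (F G : multiform R d) (b : {ffun 'I_d -> R}) (m : {vspace R}).

Lemma set_arg_id b i : set_arg b i (b i) = b.
Proof. by apply/ffunP=> j; rewrite ffunE; case: eqP => [->|]. Qed.

Lemma multilinearDr F b i (c : K) (x y : R) : multilinear F ->
  b i = c *: x + y -> F b = c * F (set_arg b i x) + F (set_arg b i y).
Proof. by move=> Flin bi; rewrite -Flin -bi set_arg_id. Qed.

(** Induction on the number of arguments that are neither 1 nor in [m]: one of them is split along
    [m + 1], and both resulting tuples have fewer. *)
Lemma multilinear_ext m F G :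
    (m + 1 = fullv)%VS -> multilinear F -> multilinear G ->
    (forall b, (forall i, b i = 1 \/ b i \in m) -> F b = G b) ->
  F =1 G.
Proof.
move=> m1 Flin Glin FG b; pose bad b := [pred i | (b i != 1) && (b i \notin m)].
have [n] := ubnP #|bad b|; elim: n b => // n IHn b; rewrite ltnS => len.
have [i bad_i|good] := pickP (bad b); last first.
  apply: FG => i; have /negbT := good i; rewrite negb_and !negbK.
  by case/orP=> [/eqP|]; [left|right].
have /memv_addP[u um [_ /vlineP[c ->] bi]] : b i \in (m + 1)%VS.
  by rewrite m1 memvf.
have IHi x : x = 1 \/ x \in m -> F (set_arg b i x) = G (set_arg b i x).
  move=> x_good; apply: IHn; apply: leq_trans len.
  apply/proper_card/properP; split; last first.
    exists i => //; rewrite !inE ffunE eqxx negb_and !negbK.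
    by case: x_good => ->; rewrite ?eqxx ?orbT.
  apply/subsetP=> j; rewrite !inE ffunE; case: (j =P i) => // _.
  by case: x_good => ->; rewrite ?eqxx ?andbF.
rewrite addrC in bi.
by rewrite (multilinearDr Flin bi) (multilinearDr Glin bi) !IHi; auto.
Qed.

(** Gives the derivative of [F] at [b] in direction [x] algebraically, as the linear coefficient of
    a polynomial in [t]. *)
Lemma multilinear_taylor1 F b (x : R) : multilinear F ->
  exists p : {poly K},
    [/\ forall t, p.[t] = F [ffun i => t *: x + b i], p`_0 = F b
      & p`_1 = \sum_i F (set_arg b i x)].
Proof.
move=> Flin.
(* Only the first [n] arguments are shifted, so that induction on [n] expands one argument at a
   time. *)
pose shift (n : nat) (c : {ffun 'I_d -> R}) t : {ffun 'I_d -> R} :=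
  [ffun i : 'I_d => if (i < n)%N then t *: x + c i else c i].
suffices /(_ d (leqnn d) b)[p [pE p0 p1]] : forall n, (n <= d)%N -> forall c,
    exists p : {poly K}, [/\ forall t, p.[t] = F (shift n c t), p`_0 = F c
      & p`_1 = \sum_(i < d | (i < n)%N) F (set_arg c i x)].
  exists p; split=> // [t|].
    by rewrite pE; congr F; apply/ffunP=> i; rewrite !ffunE ltn_ord.
  by rewrite p1; apply: eq_bigl => i; rewrite ltn_ord.
elim=> [_ c|n IHn ltnd c].
  exists (F c)%:P; rewrite !coefC big1 //; split=> // t.
  by rewrite hornerC; congr F; apply/ffunP=> i; rewrite ffunE.
have [[p [pE p0 p1]] [q [qE q0 _]]] :=
  (IHn (ltnW ltnd) c, IHn (ltnW ltnd) (set_arg c (Ordinal ltnd) x)).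
exists (q * 'X + p); split=> [t||].
- rewrite hornerD hornerMX pE qE mulrC.
  rewrite (@multilinearDr _ (shift n.+1 c t) (Ordinal ltnd) t x
    (c (Ordinal ltnd))) //.
    congr (_ * F _ + F _); apply/ffunP=> i; rewrite !ffunE -val_eqE /=.
      by rewrite ltnS; case: (ltngtP i n).
    rewrite ltnS; case: (ltngtP i n) => //= i_n.
    by congr (c _); apply: val_inj.
  by rewrite ffunE /= leqnn.
- by rewrite coefD coefMX add0r.
rewrite coefD coefMX /= q0 p1 [RHS](bigD1 (Ordinal ltnd)) //=.
congr (_ + _); apply: eq_bigl => i.
by rewrite -val_eqE /= ltnS ltn_neqAle andbC.
Qed.

End MultilinearForms.

(* A product of two forms vanishing at u vanishes to second order there. *)
Lemma form_product_derivative (K : closedFieldType) (R : comFalgType K)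
    d1 d2 d (F1 : multiform R d1) (F2 : multiform R d2) (F : multiform R d)
    (u x : R) :
    multilinear F1 -> multilinear F2 -> form_product F1 F2 F ->
    F1 [ffun=> u] = 0 -> F2 [ffun=> u] = 0 ->
  \sum_i F (set_arg [ffun=> u] i x) = 0.
Proof.
move=> F1lin F2lin [_ Flin _ FE] F1u F2u.
have [p [pE p0 <-]] := multilinear_taylor1 [ffun=> u] x Flin.
have [p1 [p1E p10 _]] := multilinear_taylor1 [ffun=> u] x F1lin.
have [p2 [p2E p20 _]] := multilinear_taylor1 [ffun=> u] x F2lin.
suffices -> : p = p1 * p2.
  rewrite coefM !big_ord_recl big_ord0 /= p10 p20 F1u F2u.
  by rewrite !(mul0r, mulr0) !addr0.
(* A nonzero polynomial over an algebraically closed field has a non-root, so agreement at every [t]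
   gives equality of polynomials. *)
apply/eqP; rewrite -subr_eq0; apply: contraT => /closed_nonrootP[t /negP[]].
have const e : [ffun i : 'I_e => t *: x + [ffun=> u] i] = [ffun=> t *: x + u].
  by apply/ffunP=> i; rewrite !ffunE.
by rewrite rootE hornerD hornerN hornerM pE p1E p2E !const FE subrr.
Qed.

(** * Existence, uniqueness, symmetry and invariance of the form *)

Section FW.
Variables (K : fieldType) (R : comFalgType K) (m : {vspace R}) (d : nat).
Variable pi : 'Hom(subvs_of m, K^o).
Implicit Types (F G : multiform R d) (b : {ffun 'I_d -> R}).

(** The value 0 from [d] on lets one formula cover the tuple of units too, whose product is outside
    [m]. *)
Definition FW_coef (k : nat) : K :=
  if (k < d)%N then (-1) ^+ k * k`!%:R * (d - k - 1)`!%:R else 0.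

Lemma FW_coef_rec k : (k.+1 < d)%N ->
  k.+1%:R * FW_coef k + (d - k.+1)%:R * FW_coef k.+1 = 0.
Proof.
move=> ltkd; rewrite /FW_coef ltkd (ltnW ltkd) -(subnSK (ltnW ltkd)).
by rewrite -(subnSK ltkd) !subn1 /= exprS !factS !natrM; ring.
Qed.

Lemma FW_coef_neq0 k : [pchar K] =i pred0 -> (k < d)%N -> FW_coef k != 0.
Proof.
move=> /pcharf0P K0 ltkd; rewrite /FW_coef ltkd !mulf_neq0 ?signr_eq0 //.
  by rewrite K0 -lt0n fact_gt0.
by rewrite K0 -lt0n fact_gt0.
Qed.

(** Each argument is expanded into its components in [1] and [m]; [S] is the set of positions where
    the scalar component is taken. Multilinearity is thus built in. *)
Definition FW_form : multiform R d := fun b =>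
  \sum_(S : {set 'I_d}) FW_coef #|S| * pi (vsproj m
    (\prod_i (if i \in S then daddv_pi 1 m else daddv_pi m 1)%VS (b i))).

Lemma FW_form_multilinear : multilinear FW_form.
Proof.
move=> b i c x y; rewrite /FW_form mulr_sumr -big_split.
apply: eq_bigr => S _ /=.
pose g j := if j \in S then daddv_pi 1 m else daddv_pi m 1%VS.
have prod_set_arg z :
    \prod_j g j (set_arg b i z j) = g i z * \prod_(j | j != i) g j (b j).
  rewrite (bigD1 i) //= ffunE eqxx; congr (_ * _).
  by apply: eq_bigr => j /negPf ji; rewrite ffunE ji.
rewrite !prod_set_arg linearP mulrDl -scalerAl !linearP mulrDr.
by congr (_ + _); apply: mulrCA.
Qed.

Hypotheses (m1 : (m + 1 = fullv)%VS) (mI1 : (m :&: 1 = 0)%VS) (idm : ideal m).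

Lemma one_notin_max : 1 \notin m.
Proof.
apply/negP=> m_1; have : 1 \in (m :&: 1)%VS by rewrite memv_cap m_1 memv_line.
by rewrite mI1 memv0 oner_eq0.
Qed.

Lemma FW_formE b : (forall i, b i = 1 \/ b i \in m) ->
  FW_form b = FW_coef #|[set i | b i == 1]| * pi (vsproj m (\prod_i b i)).
Proof.
move=> b_good; have Im1 : (1 :&: m = 0)%VS by rewrite capvC.
have proj0 (U V : {vspace R}) x : (U :&: V = 0)%VS -> (V :&: U = 0)%VS ->
    (V + U = fullv)%VS -> x \in V -> daddv_pi U V x = 0.
  move=> UV VU VUf xV; have := daddv_pi_add VU (_ : x \in V + U)%VS.
  rewrite VUf memvf daddv_pi_id // => /(_ isT)/eqP.
  by rewrite addrC -subr_eq0 addrK => /eqP.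
rewrite /FW_form (bigD1 [set i | b i == 1]) //= [X in _ + X]big1 ?addr0.
  congr (_ * _); congr (pi (vsproj m _)); apply: eq_bigr => i _; rewrite inE.
  case: eqP => [->|bi]; rewrite daddv_pi_id ?memv_line //.
  by case: (b_good i).
move=> S S_neq.
suffices -> :
    \prod_i (if i \in S then daddv_pi 1 m else daddv_pi m 1)%VS (b i) = 0.
  by rewrite !linear0 mulr0.
(* If [S] is not the set of unit positions, some factor projects a unit to [m] or an element of [m]
   to [1], and is 0. *)
have /existsP[i Si] : [exists i, (i \in S) != (b i == 1)].
  apply: contraR S_neq => /existsPn S_eq; apply/eqP/setP=> i.
  by have := S_eq i; rewrite inE negbK => /eqP.
rewrite (bigD1 i) //=; move: Si; case: (b i =P 1) => [->|bi] /=.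
  by case: (i \in S) => // _; rewrite proj0 ?mul0r // ?memv_line // addvC.
by case: (i \in S) => // _; rewrite proj0 ?mul0r //; case: (b_good i).
Qed.

Lemma FW_form_spec : is_FW pi FW_form.
Proof.
split=> [||b b_good /= ltk]; first exact: FW_form_multilinear.
  rewrite FW_formE => [|i]; last by left; rewrite ffunE.
  rewrite (_ : [set i | _] = setT) ?cardsT ?card_ord /FW_coef ?ltnn ?mul0r //.
  by apply/setP=> i; rewrite !inE ffunE eqxx.
by rewrite FW_formE // /FW_coef ltk.
Qed.

(** This drops the restriction [k < d]: otherwise all arguments are 1 and both sides vanish. *)
Lemma is_FW_E F b : is_FW pi F -> (forall i, b i = 1 \/ b i \in m) ->
  F b = FW_coef #|[set i | b i == 1]| * pi (vsproj m (\prod_i b i)).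
Proof.
case=> Flin F1 FE b_good; rewrite /FW_coef; case: ltnP => [/(FE b b_good)//|].
rewrite mul0r => led; rewrite -F1; congr F; apply/ffunP=> i; rewrite ffunE.
have /eqP/setP/(_ i) : [set i | b i == 1] == setT.
  by rewrite eqEcard subsetT cardsT card_ord.
by rewrite !inE => /eqP.
Qed.

Lemma is_FW_unique F G : is_FW pi F -> is_FW pi G -> F =1 G.
Proof.
move=> FW GW; apply: (multilinear_ext m1) => [||b b_good]; first by case: FW.
  by case: GW.
by rewrite !is_FW_E.
Qed.

(** On tuples of units and elements of [m], the value depends only on the number of units and the
    product, both unchanged by permutation. *)
Lemma is_FW_symmetric F : is_FW pi F -> Defs.symmetric_form F.
Proof.
move=> FW s; pose G b := F [ffun i => b (s i)].
have [Flin _ _] := FW.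
apply: (multilinear_ext (F := G) m1) => // [b i c x y|b b_good].
  have set_argE z : [ffun j => set_arg b i z (s j)] =
      set_arg [ffun j => b (s j)] (s^-1%g i) z.
    by apply/ffunP=> j; rewrite !ffunE (can2_eq (permK s) (permKV s)).
  by rewrite /G !set_argE Flin.
rewrite /G !is_FW_E // => [|i]; last by rewrite ffunE.
rewrite [in RHS](reindex_inj (@perm_inj _ s)) /=.
congr (FW_coef _ * _); last first.
  by congr (pi (vsproj m _)); apply: eq_bigr => i _; rewrite ffunE.
rewrite -[RHS](card_preimset _ (@perm_inj _ s)).
by apply: eq_card => i; rewrite !inE ffunE.
Qed.

Lemma is_FW_invariant F (W : {vspace R}) (a : R) b : is_FW pi F ->
    (forall x, x \in W -> pi (vsproj m x) = 0) -> (W <= m)%VS ->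
    (m ^+ d.+1 <= W)%VS -> a \in W ->
  \sum_(i < d) F (set_arg b i (a * b i)) = 0.
Proof.
move=> FW piW /subvP sWm /subvP smW aW; have [Flin _ _] := FW.
pose G b : K := \sum_(i < d) F (set_arg b i (a * b i)).
suffices /(_ b) : G =1 (fun=> 0) by [].
(* The invariance sum is itself multilinear in [b], so it is compared with the zero form. *)
apply: (multilinear_ext (F := G) m1) => {b} [b i c x y|b i c x y|b b_good].
- rewrite /G mulr_sumr -big_split; apply: eq_bigr => j _ /=.
  have [->|j_neqi] := eqVneq j i.
    have set_arg2 z : set_arg (set_arg b i z) i (a * set_arg b i z i) =
        set_arg b i (a * z).
      by apply/ffunP=> l; rewrite !ffunE eqxx; case: eqP.
    by rewrite !set_arg2 mulrDr -scalerAr Flin.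
  have set_argC z : set_arg (set_arg b i z) j (a * set_arg b i z j) =
      set_arg (set_arg b j (a * b j)) i z.
    apply/ffunP=> l; rewrite !ffunE (negPf j_neqi).
    by case: eqP => [->|//]; rewrite (negPf j_neqi).
  by rewrite !set_argC Flin.
- by rewrite mulr0 addr0.
set ones := [set i | b i == 1]; set k := #|ones|.
pose l := pi (vsproj m (a * \prod_i b i)) : K.
have am : a \in m by apply: sWm.
have abm i : a * b i \in m by rewrite mulrC; apply: idm.
(* As [a * b i] lies in [m], it is never 1: the unit count drops by one exactly when [b i] was a
   unit. *)
have F_arg i : F (set_arg b i (a * b i)) =
    FW_coef (if i \in ones then k.-1 else k) * l.
  rewrite is_FW_E // => [|j]; last first.
    by rewrite ffunE; case: eqP => _; [right|exact: b_good].
  congr (FW_coef _ * _); last first.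
    congr (pi (vsproj m _)).
    rewrite (bigD1 i) // [in RHS](bigD1 i) //= mulrA ffunE eqxx; congr (_ * _).
    by apply: eq_bigr => j /negPf ji; rewrite ffunE ji.
  have -> : [set j | set_arg b i (a * b i) j == 1] = ones :\ i.
    apply/setP=> j; rewrite !inE ffunE; case: (j =P i) => //= _.
    by apply/negbTE; apply: contraNneq one_notin_max => <-.
  rewrite /k (cardsD1 i ones); case: (i \in ones) => //=.
rewrite /G; under eq_bigr do rewrite F_arg.
rewrite -mulr_suml (bigID (mem ones)) /=.
under eq_bigr => i i1 do rewrite i1.
under [X in _ + X]eq_bigr => i i1 do rewrite (negPf i1).
rewrite !sumr_const -/k.
have -> : #|[pred i | i \notin ones]| = (d - k)%N.
  by have /(canRL (addKn _)) := cardC (mem ones); rewrite card_ord.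
have led : (k <= d)%N by have := max_card (mem ones); rewrite card_ord.
(* Without units the product has [d.+1] factors in [m], so it lies in [W]; with units only it is
   [a], again in [W]. Between these extremes the recurrence cancels the two groups of terms. *)
have [k0|k_gt0] := posnP k.
  rewrite /l piW ?mulr0 // smW // expvSl memv_mul // memv_expv // => i.
  case: (b_good i) => // bi1; have := card0_eq k0 i.
  by rewrite inE bi1 eqxx.
move: led; rewrite leq_eqVlt => /predU1P[kd|ltkd].
  rewrite /l big1 ?mulr1 ?piW ?mulr0 // => i _; apply/eqP.
  have /setP/(_ i) : ones = setT.
    by apply/eqP; rewrite eqEcard subsetT cardsT card_ord -/k kd leqnn.
  by rewrite !inE.
have := @FW_coef_rec k.-1; rewrite prednK // => /(_ ltkd).
by rewrite !mulr_natl => ->; rewrite mul0r.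
Qed.

End FW.

(** * Nonvanishing on the maximal ideal and irreducibility *)

Theorem lemma1 (K : closedFieldType) (charK0 : [pchar K] =i pred0)
    (R : comFalgType K) (m : {vspace R}) (Rlocal : local_algebra m)
    (W : {vspace R}) (Whyp : hyperplane m W) (Wgen : generates W)
    (d : nat) (mdW : ~~ (m ^+ d <= W)%VS)
    (dmax : forall e : nat, (d < e)%N -> (m ^+ e <= W)%VS)
    (Q : vectType K) (q : 'Hom(subvs_of m, Q))
    (Qquot : quotient_map (fun x : subvs_of m => vsval x \in W) q)
    (iso : 'Hom(Q, K^o)) (iso_bij : bijective iso) :
  exists FW : multiform R d,
    [/\ is_FW (iso \o q)%VF FW,
        forall G : multiform R d, is_FW (iso \o q)%VF G -> G =1 FW,
        invariant_form m W FW
      & irreducible_form m FW].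
Proof.
have [m1 mI1] := local_algebra_decomp Rlocal.
have [[[idm _ _] _] [sWm dimW]] := (Rlocal, Whyp).
set pi := (iso \o q)%VF.
have piE x : x \in m -> (pi (vsproj m x) == 0) = (x \in W).
  move=> xm; rewrite /pi comp_lfunE -{1}(linear0 iso) (bij_eq iso_bij) Qquot.2.
  by rewrite vsprojK.
have piW x : x \in W -> pi (vsproj m x) = 0.
  by move=> xW; apply/eqP; rewrite piE ?(subvP sWm).
have nmW : ~~ (m <= W)%VS by apply/negP=> /dimvS; rewrite dimW ltnn.
(* If [d] were 0, its maximality would put [m] inside [W]. *)
have d_gt0 : (0 < d)%N.
  by rewrite lt0n; apply: contra nmW => /eqP d0; apply: (dmax 1); rewrite d0.
have FW := FW_form_spec d pi m1 mI1.
have [Flin FW1 _] := FW.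
exists (FW_form pi); split=> // [G GW||].
- exact: (is_FW_unique m1 GW FW).
- split=> //; first by split=> //; exact: (is_FW_symmetric m1 FW).
    (* A product of [d] elements of [m] outside [W] witnesses nonvanishing: no argument is a unit,
       and the coefficient is nonzero in characteristic zero. *)
    have [b [bm bW]] := expv_nsubP mdW.
    exists (finfun b); split=> [i|]; first by rewrite ffunE.
    rewrite (is_FW_E FW) => [|i]; last by right; rewrite ffunE.
    have -> : [set i | finfun b i == 1] = set0.
      apply/setP=> i; rewrite !inE ffunE; apply/negbTE.
      by apply: contraNneq (one_notin_max mI1) => <-.
    rewrite cards0 mulf_neq0 ?FW_coef_neq0 //.
    have -> : \prod_i finfun b i = \prod_i b i.
      by apply: eq_bigr => i _; rewrite ffunE.
    by rewrite piE // (bigD1 (Ordinal d_gt0)) //= mulrC idm.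
  by move=> a b; apply: (is_FW_invariant m1 mI1 idm _ FW piW sWm (dmax _ (ltnSn d))).
case=> d1 [d2 [F1 [F2 [W' [[[F1lin _] F1u _ _ _] [[F2lin _] F2u _ _ _]]]]]].
move=> /(form_product_derivative _ F1lin F2lin)/(_ F1u F2u) deriv0.
have /subvPn[x xm xW] := nmW; have /eqP := deriv0 x.
(* Each term of the derivative at 1 has [d.-1] units and product [x], so the sum is [d] times one
   nonzero value. *)
have argE (i : 'I_d) : FW_form pi (set_arg [ffun=> 1] i x) =
    FW_coef K d d.-1 * pi (vsproj m x).
  rewrite (is_FW_E FW) => [|j]; last first.
    by rewrite !ffunE; case: eqP => _; [right|left].
  congr (FW_coef _ _ _ * _).
    have -> : [set j | set_arg [ffun=> 1] i x j == 1] = ~: [set i].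
      apply/setP=> j; rewrite !inE !ffunE; case: (j =P i) => [_|].
        by apply: contraNF (one_notin_max mI1) => /eqP <-.
      by rewrite eqxx.
    by have := cardsC1 i; rewrite card_ord.
  congr (pi (vsproj m _)); rewrite (bigD1 i) //= ffunE eqxx big1 ?mulr1 //.
  by move=> j /negPf ji; rewrite !ffunE ji.
under eq_bigr do rewrite argE.
rewrite sumr_const card_ord -mulr_natl; apply/negP; rewrite !mulf_neq0 //.
- by have /pcharf0P-> := charK0; rewrite -lt0n.
- by rewrite FW_coef_neq0 // prednK.
by rewrite piE.
Qed.
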